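(* Suppose that the optimization algorithm $\mathcal{T}$ is at least q-linearly convergent over $\Gamma$ (with constants $\varepsilon,\eta,q$), and suppose that all points $(z,x)$ with $x\in\Gamma$, $z\in S(x)$ that correspond to minimizers of the OCP are strongly regular. Let $a,\theta:\mathbb{Z}_{++}\to\mathbb{R}_{++}$ be functions, monotonically decreasing in $\ell$ and tending to $0$ as $\ell\to\infty$, with $a(\ell)\in(0,1)$, such that $\|e_{k+1}\|\le a(\ell)\|e_k\|+\theta(\ell)\|\Delta x_k\|$ whenever $\|e_k\|+b\|\Delta x_k\|\le\varepsilon$, where $b$ is the Lipschitz constant of $\bar s$ over $\Gamma$ and $e$ evolves according to the error system $e_{k+1}=\mathcal{G}_\ell(e_k,x_k,\Delta x_k)$ given in the context. Put $\sigma(\ell)=\theta(\ell)/(1-a(\ell))$. Then there exists $\tau:\mathbb{Z}_{++}\to\mathbb{R}_{++}$, namely $\tau(\ell)=\tfrac12(\sigma(\ell)+b)^{-1}$, such that for every $\ell\in\mathbb{Z}_{++}$ the error system is LISS with respect to the inputs $(\Delta x,x)$ under the restrictions $$\|e_0\|\le \tfrac12\varepsilon,\qquad \|\Delta\mathbf{x}\|\le\tau(\ell)\varepsilon .$$ Further, the asymptotic gain of the error system is of the form $$\gamma_\ell(s)=2\sigma(\ell)s_1+0\cdot s_2,$$ where $s_1$ and $s_2$ correspond to the $\Delta x$ and $x$ inputs respectively (i.e. whenever $\|e_0\|\le\tfrac12\varepsilon$ and $\|\Delta\mathbf{x}\|\le\tau(\ell)\varepsilon$, one has $\overline{\lim}_{k\to\infty}\|e_k\|\le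 2\sigma(\ell)\,\overline{\lim}_{k\to\infty}\|\Delta x_k\|$), and $\sigma(\ell)\to0$ monotonically as $\ell\to\infty$.
   Context: Notation: $\mathbb{Z}_{+}$ ($\mathbb{Z}_{++}$) are the non-negative (positive) integers, $\mathbb{R}_{++}$ the positive reals, $\|\cdot\|$ the Euclidean norm, and $\|\mathbf{u}\|=\sup_k\|u_k\|$ for a sequence $\mathbf u$. Class $\mathcal{K}$: continuous, strictly increasing, zero at zero; $\mathcal{K}_\infty$: in addition unbounded; $\beta\in\mathcal{KL}$: $\beta(\cdot,s)\in\mathcal{K}$ for each $s\ge0$ and $\beta(r,s)\to0$ as $s\to\infty$ for each $r$. $\mathcal{N}_K$ is the normal cone mapping of a closed convex set $K$ (empty outside $K$). OCP (standing assumptions). $x_{k+1}=f_d(x_k,u_k,d_k)$ with $x_k\in\mathcal{X}\subset\mathbb{R}^{n_x}$, $u_k\in\mathcal{U}\subset\mathbb{R}^{n_u}$, $d_k\in\mathcal{D}\subset\mathbb{R}^{n_d}$; $\mathcal{X},\mathcal{U},\mathcal{D}$ are compact and contain the origin; $f_d$ is twice continuously differentiable in its first two arguments, Lipschitz in the third, and $f_d(0,0,0)=0$. The OCP with parameter $x$ is: minimize $\phi(\xi,\mu)=V_f(\xi_N)+\sum_{i=0}^{N-1}l(\xi_i,\mu_i)$ over $\xi=(\xi_0,\dots,\xi_N)$, $\mu=(\mu_0,\dots,\mu_{N-1})$ subject to $\xi_{i+1}=f_d(\xi_i,\mu_i,0)$, $\xi_0=x$, $\xi_N\in\mathcal{X}_f\subseteq\mathcal{X}$,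 $(\xi_i,\mu_i)\in\mathcal{Z}\subseteq\mathcal{X}\times\mathcal{U}$ for $i=0,\dots,N-1$. All functions in the OCP are twice continuously differentiable with Lipschitz second derivatives. $l(0,0)=0$ and there is $\alpha_l\in\mathcal{K}_\infty$ with $\alpha_l(\|x\|)\le l(x,u)$ on $\mathcal{Z}$; $\mathcal{X}_f$ contains the origin in its interior and for all $x\in\mathcal{X}_f$ there is $u$ with $(x,u)\in\mathcal{Z}$, $f_d(x,u,0)\in\mathcal{X}_f$; $V_f$ is a control Lyapunov function with $\min_u\{V_f(x^+)-V_f(x)+l(x,u)\mid(x,u)\in\mathcal{Z},\ x^+\in\mathcal{X}_f\}\le0$ for all $x\in\mathcal{X}_f$, $x^+=f_d(x,u,0)$. $\Gamma=\{x\in\mathcal{X}\mid\text{the OCP is feasible}\}$ is compact and a minimizer exists for each $x\in\Gamma$. Necessary conditions. The first order necessary conditions of the OCP are written as a generalized equation $F(z,x)+\mathcal{N}_K(z)\ni0$ with $K\subseteq\mathbb{R}^n$ closed convex and $F:\mathbb{R}^n\times\Gamma\to\mathbb{R}^n$; $z$ includes $\mu$ and possibly $\xi$ and multipliers. $S(x)=\{z\mid F(z,x)+\mathcal{N}_K(z)\ni0\}$. A set-valued mapping $\Psi:\mathbb{R}^n\rightrightarrows\mathbb{R}^n$ is strongly regular at $\bar z$ for $\bar y$ if $\bar y\in\Psi(\bar z)$ and there are neighborhoods $U$ of $\bar z$, $V$ of $\bar y$ such that $y\mapsto\Psi^{-1}(y)\cap U$ is single-valued and Lipschitz on $V$. A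 point $(\bar z,\bar x)$ with $\bar z\in S(\bar x)$ is strongly regular if $z\mapsto F(z,\bar x)+\mathcal{N}_K(z)$ is strongly regular at $\bar z$ for $0$. Algorithm. $\mathcal{T}:\mathbb{R}^n\times\Gamma\times\mathbb{Z}_+\to\mathbb{R}^n$; $\mathcal{T}_0(z,x)=z$, $\mathcal{T}_\ell(z,x)=\mathcal{T}(\mathcal{T}_{\ell-1}(z,x),x,\ell)$ for $\ell\in\mathbb{Z}_{++}$. $\mathcal{T}$ converges at least q-linearly over $\Gamma$ if there are $\varepsilon>0$, $\eta>0$, $q\ge1$ with $\eta\varepsilon^{q-1}<1$ such that for all $x\in\Gamma$, $z^*\in S(x)$ and all $z$ with $\|z-z^*\|\le\varepsilon$: $\lim_{\ell\to\infty}\mathcal{T}_\ell(z,x)=z^*$ and $\|\mathcal{T}_\ell(z,x)-z^*\|\le\eta\|\mathcal{T}_{\ell-1}(z,x)-z^*\|^q$ for all $\ell>0$. Error system. $\bar s:\Gamma\to\mathbb{R}^n$ is an isolated single-valued restriction of $S$, $\bar s(x)\in S(x)$, corresponding to minimizers and Lipschitz on $\Gamma$ with constant $b$. The optimizer is $z_k=\mathcal{T}_\ell(z_{k-1},x_k)$; with $e_k=z_k-\bar s(x_k)$, $\Delta x_k=x_{k+1}-x_k$ (all $x_k\in\Gamma$), the error system is $e_{k+1}=\mathcal{G}_\ell(e_k,x_k,\Delta x_k)=\mathcal{T}_\ell(e_k+\bar s(x_k),x_k+\Delta x_k)-\bar s(x_k+\Delta x_k)$, with output $\Delta u_k=\Xi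 e_k$, where $\Xi$ is a surjective matrix selecting $\mu_0$ from $z$. $\Delta\mathbf{x}$ and $\mathbf{x}$ denote the sequences $(\Delta x_k)$ and $(x_k)$. LISS under given restrictions on initial state and inputs means: there exist $\beta\in\mathcal{KL}$ and $\gamma\in\mathcal{K}$ such that $\|e_k\|\le\max\{\beta(\|e_0\|,k),\gamma(\|(\Delta\mathbf{x},\mathbf{x})\|)\}$ for all $k\in\mathbb{Z}_+$ whenever the restrictions hold. An asymptotic gain is a function $\gamma$ such that the limsup of the state norm is bounded by $\gamma$ of the limsup of the input norms. *)

(* Defs.v *)
From HB Require Import structures.
From mathcomp Require Export all_boot all_order all_algebra.
From mathcomp Require Export all_classical all_reals all_analysis.
Export Order.TTheory GRing.Theory Num.Theory.
Export numFieldNormedType.Exports.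

Set Implicit Arguments.
Unset Strict Implicit.
Unset Printing Implicit Defensive.

Local Open Scope classical_set_scope.
Local Open Scope ring_scope.

(* The library norm [`|v|] on matrices is the max norm, so the Euclidean norm
   is introduced separately. Both induce the library topology, hence the
   library notions of limit, neighbourhood, compactness, differentiability,
   and Lipschitz continuity with unspecified constant are used as they are. *)
Definition enorm (R : realType) (n : nat) (v : 'cV[R]_n) : R :=
  Num.sqrt (\sum_(i < n) v i 0 ^+ 2).

Definition edot (R : realType) (n : nat) (v w : 'cV[R]_n) : R :=
  \sum_(i < n) v i 0 * w i 0.

(* [sup] of an unbounded set is 0 in the library, so [seqnorm] is meaningful
   for bounded sequences only; the inputs it is applied to below remain in a
   compact set (or are differences of elements of a compact set). *)
Definition seqnorm (R : realType) (n : nat) (u : nat -> 'cV[R]_n) : R :=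
  sup (range (fun k => enorm (u k))).

Section ComparisonFunctions.
Variable R : realType.

Definition classK (g : R -> R) : Prop :=
  [/\ {within [set r : R | 0 <= r], continuous g},
      (forall r s, 0 <= r -> r < s -> g r < g s) & g 0 = 0].

Definition classKinf (g : R -> R) : Prop :=
  classK g /\ forall M : R, exists2 r, 0 <= r & M < g r.

Definition classKL (beta : R -> R -> R) : Prop :=
  (forall s, 0 <= s -> classK (beta ^~ s)) /\
  (forall r, 0 <= r -> beta r s @[s --> +oo] --> 0).

End ComparisonFunctions.

Section Smoothness.
Variables (R : realType) (V W : normedModType R).

(* The functions of the control problem are only meaningful on compact sets, so
   smoothness is required on an open neighbourhood of the relevant set. *)
Definition C1_on (O : set V) (f : V -> W) : Prop :=
  forall p, O p -> differentiable f p /\ forall v, {for p, continuous ('D_v f)}.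

Definition C2_on (O : set V) (f : V -> W) : Prop :=
  C1_on O f /\ forall v, C1_on O ('D_v f).

Definition C2_near (A : set V) (f : V -> W) : Prop :=
  exists O : set V, [/\ open O, A `<=` O & C2_on O f].

Definition C2_lip_near (A : set V) (f : V -> W) : Prop :=
  exists O : set V, [/\ open O, A `<=` O, C2_on O f &
    forall v w, [lipschitz 'D_w ('D_v f) p | p in O]].

Definition bouligand_cone (A : set V) (p : V) : set V :=
  [set d | exists (t : nat -> R) (v : nat -> V),
    [/\ forall k, 0 < t k, t @ \oo --> 0, v @ \oo --> d &
        forall k, A (p + t k *: v k)]].

End Smoothness.

Record ocp (R : realType) (nx nu nd N : nat) := Ocp {
  stateset : set 'cV[R]_nx;
  inputset : set 'cV[R]_nu;
  distset : set 'cV[R]_nd;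
  dyn : 'cV[R]_nx -> 'cV[R]_nu -> 'cV[R]_nd -> 'cV[R]_nx;
  stage : 'cV[R]_nx -> 'cV[R]_nu -> R;
  terminal : 'cV[R]_nx -> R;
  mixedset : set ('cV[R]_nx * 'cV[R]_nu);
  terminalset : set 'cV[R]_nx }.

Section OCP.
Variables (R : realType) (nx nu nd N : nat) (P : ocp R nx nu nd N).

Local Notation X := (stateset P).
Local Notation U := (inputset P).
Local Notation D := (distset P).
Local Notation fd := (dyn P).
Local Notation l := (stage P).
Local Notation Vf := (terminal P).
Local Notation Z := (mixedset P).
Local Notation Xf := (terminalset P).

(* A candidate [(xi, mu)] stores xi_0, ..., xi_N and mu_0, ..., mu_(N-1)
   as the columns of two matrices. *)
Definition plan : Type := ('M[R]_(nx, N.+1) * 'M[R]_(nu, N))%type.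

Definition xi_at (p : plan) (i : 'I_N) : 'cV[R]_nx :=
  col (widen_ord (leqnSn N) i) p.1.
Definition xi_next (p : plan) (i : 'I_N) : 'cV[R]_nx := col (lift ord0 i) p.1.
Definition mu_at (p : plan) (i : 'I_N) : 'cV[R]_nu := col i p.2.

Definition cost (p : plan) : R :=
  Vf (col ord_max p.1) + \sum_(i < N) l (xi_at p i) (mu_at p i).

Definition feasible (x : 'cV[R]_nx) : set plan :=
  [set p | [/\ forall i, xi_next p i = fd (xi_at p i) (mu_at p i) 0,
               col ord0 p.1 = x,
               Xf (col ord_max p.1) &
               forall i, Z (xi_at p i, mu_at p i)]].

Definition minimizer (x : 'cV[R]_nx) : set plan :=
  [set p | feasible x p /\ forall p', feasible x p' -> cost p <= cost p'].

Definition Gamma : set 'cV[R]_nx :=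
  [set x | X x /\ exists p, feasible x p].

Definition stationary (x : 'cV[R]_nx) : set plan :=
  [set p | feasible x p /\
    forall d, bouligand_cone (feasible x) p d -> 0 <= 'D_d cost p].

Definition admissible_input (x : 'cV[R]_nx) : set 'cV[R]_nu :=
  [set u | Z (x, u) /\ Xf (fd x u 0)].

Definition clf_decrease (x : 'cV[R]_nx) : Prop :=
  let delta u := Vf (fd x u 0) - Vf x + l x u in
  exists u, [/\ admissible_input x u,
    forall u', admissible_input x u' -> delta u <= delta u' & delta u <= 0].

Record ocp_assumptions : Prop := OcpAssumptions {
  horizon_pos : (0 < N)%N;
  compact_sets : [/\ compact X, compact U & compact D];
  origin_sets : [/\ X 0, U 0 & D 0];
  dyn_C2 : forall d, D d -> C2_near (X `*` U) (fun p => fd p.1 p.2 d);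
  dyn_lipschitz : exists L : R, forall x u d d', X x -> U u -> D d -> D d' ->
    enorm (fd x u d - fd x u d') <= L * enorm (d - d');
  dyn_origin : fd 0 0 0 = 0;
  Xf_sub : Xf `<=` X;
  Z_sub : Z `<=` X `*` U;
  nominal_smooth : C2_lip_near (X `*` U) (fun p => fd p.1 p.2 0);
  stage_smooth : C2_lip_near (X `*` U) (fun p => l p.1 p.2);
  terminal_smooth : C2_lip_near X Vf;
  stage_origin : l 0 0 = 0;
  stage_lower : exists2 alpha, classKinf alpha &
    forall x u, Z (x, u) -> alpha (enorm x) <= l x u;
  Xf_origin : nbhs (0 : 'cV[R]_nx) Xf;
  Xf_invariant : forall x, Xf x -> exists u, admissible_input x u;
  Vf_posdef : Vf 0 = 0 /\ forall x, Xf x -> x != 0 -> 0 < Vf x;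
  Vf_decrease : forall x, Xf x -> clf_decrease x;
  Gamma_compact : compact Gamma;
  minimizer_exists : forall x, Gamma x -> exists p, minimizer x p }.

End OCP.

Section GeneralizedEquation.
Variables (R : realType) (n : nat).

Definition normal_cone (K : set 'cV[R]_n) (z : 'cV[R]_n) : set 'cV[R]_n :=
  [set w | K z /\ forall y, K y -> edot w (y - z) <= 0].

Definition strongly_regular (Psi : 'cV[R]_n -> set 'cV[R]_n)
    (zbar ybar : 'cV[R]_n) : Prop :=
  Psi zbar ybar /\
  exists (U V : set 'cV[R]_n) (s : 'cV[R]_n -> 'cV[R]_n),
    [/\ nbhs zbar U, nbhs ybar V,
        forall y, V y -> [set z | Psi z y] `&` U = [set s y] &
        [lipschitz s y | y in V]].

Variable nx : nat.

(* [F z x] is relevant for [x] in [Gamma] only; the same convention holds for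
   the algorithm [T] and the map [sbar] below. *)
Definition ge_map (F : 'cV[R]_n -> 'cV[R]_nx -> 'cV[R]_n) (K : set 'cV[R]_n)
    (x : 'cV[R]_nx) (z : 'cV[R]_n) : set 'cV[R]_n :=
  [set F z x + w | w in normal_cone K z].

Definition ge_sol (F : 'cV[R]_n -> 'cV[R]_nx -> 'cV[R]_n) (K : set 'cV[R]_n)
    (x : 'cV[R]_nx) : set 'cV[R]_n :=
  [set z | ge_map F K x z 0].

End GeneralizedEquation.

Section NecessaryConditions.
Variables (R : realType) (nx nu nd N n : nat) (P : ocp R nx nu nd N).

(* [jmu (i, k)] is the position in z of the i-th component of mu_k. *)
Definition mu_part (jmu : 'I_nu * 'I_N -> 'I_n) (z : 'cV[R]_n) : 'M[R]_(nu, N) :=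
  \matrix_(i, k) z (jmu (i, k)) 0.

(* xi is not required to be part of z: it is determined by x and mu. *)
Definition represents_minimizer (jmu : 'I_nu * 'I_N -> 'I_n)
    (x : 'cV[R]_nx) (z : 'cV[R]_n) : Prop :=
  exists xi, minimizer P x (xi, mu_part jmu z).

(* The generalized equation F(z,x) + N_K(z) containing 0 expresses the first
   order necessary conditions: each minimizer is represented by a solution,
   and each solution represents a feasible point that is stationary to first
   order. *)
Record first_order_conditions (jmu : 'I_nu * 'I_N -> 'I_n)
    (F : 'cV[R]_n -> 'cV[R]_nx -> 'cV[R]_n) (K : set 'cV[R]_n) : Prop :=
  FirstOrderConditions {
  K_closed : closed K;
  K_convex : @convex_set R 'cV[R]_n K;
  mu_selection : injective jmu;
  foc_necessary : forall x p, Gamma P x -> minimizer P x p ->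
    exists2 z, ge_sol F K x z & mu_part jmu z = p.2;
  foc_first_order : forall x z, Gamma P x -> ge_sol F K x z ->
    exists xi, stationary P x (xi, mu_part jmu z) }.

Definition selects_mu0 (jmu : 'I_nu * 'I_N -> 'I_n) (Xi : 'M[R]_(nu, n)) : Prop :=
  (forall u : 'cV[R]_nu, exists z : 'cV[R]_n, Xi *m z = u) /\
  (forall (z : 'cV[R]_n) (i0 : 'I_N), i0 = 0%N :> nat ->
    Xi *m z = col i0 (mu_part jmu z)).

(* The second field says that (x, sbar x) has a neighbourhood in which the
   graph of S coincides with that of sbar, at each x in Gamma. *)
Record isolated_minimizer_selection (jmu : 'I_nu * 'I_N -> 'I_n)
    (F : 'cV[R]_n -> 'cV[R]_nx -> 'cV[R]_n) (K : set 'cV[R]_n)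
    (sbar : 'cV[R]_nx -> 'cV[R]_n) (b : R) : Prop :=
  IsolatedMinimizerSelection {
  sel_solution : forall x, Gamma P x -> ge_sol F K x (sbar x);
  sel_isolated : forall x, Gamma P x ->
    exists (W : set 'cV[R]_nx) (V : set 'cV[R]_n),
      [/\ nbhs x W, nbhs (sbar x) V &
          forall y, Gamma P y -> W y -> ge_sol F K y `&` V = [set sbar y]];
  sel_minimizer : forall x, Gamma P x -> represents_minimizer jmu x (sbar x);
  sel_const_ge0 : 0 <= b;
  sel_lipschitz : forall x y, Gamma P x -> Gamma P y ->
    enorm (sbar x - sbar y) <= b * enorm (x - y) }.

Fixpoint algo_iter (T : 'cV[R]_n -> 'cV[R]_nx -> nat -> 'cV[R]_n)
    (l : nat) (z : 'cV[R]_n) (x : 'cV[R]_nx) : 'cV[R]_n :=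
  if l is l'.+1 then T (algo_iter T l' z x) x l else z.

Definition q_linearly_convergent
    (F : 'cV[R]_n -> 'cV[R]_nx -> 'cV[R]_n) (K : set 'cV[R]_n)
    (T : 'cV[R]_n -> 'cV[R]_nx -> nat -> 'cV[R]_n) (eps eta q : R) : Prop :=
  [/\ 0 < eps, 0 < eta, 1 <= q, eta * eps `^ (q - 1) < 1 &
    forall x zs z, Gamma P x -> ge_sol F K x zs -> enorm (z - zs) <= eps ->
      (algo_iter T l z x @[l --> \oo] --> zs) /\
      (forall l, (0 < l)%N ->
        enorm (algo_iter T l z x - zs)
          <= eta * enorm (algo_iter T l.-1 z x - zs) `^ q)].

Definition error_step (T : 'cV[R]_n -> 'cV[R]_nx -> nat -> 'cV[R]_n)
    (sbar : 'cV[R]_nx -> 'cV[R]_n) (l : nat)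
    (e : 'cV[R]_n) (x dx : 'cV[R]_nx) : 'cV[R]_n :=
  algo_iter T l (e + sbar x) (x + dx) - sbar (x + dx).

Definition error_system (T : 'cV[R]_n -> 'cV[R]_nx -> nat -> 'cV[R]_n)
    (sbar : 'cV[R]_nx -> 'cV[R]_n) (l : nat)
    (e : nat -> 'cV[R]_n) (dx x : nat -> 'cV[R]_nx) : Prop :=
  forall k, [/\ Gamma P (x k), x k.+1 = x k + dx k &
                e k.+1 = error_step T sbar l (e k) (x k) (dx k)].

End NecessaryConditions.

Section Stability.
Variables (R : realType) (nx n : nat).
Variable sys : (nat -> 'cV[R]_n) -> (nat -> 'cV[R]_nx) -> (nat -> 'cV[R]_nx) -> Prop.
Variable restriction : 'cV[R]_n -> (nat -> 'cV[R]_nx) -> (nat -> 'cV[R]_nx) -> Prop.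

Definition LISS : Prop :=
  exists (beta : R -> R -> R) (gamma : R -> R),
    [/\ classKL beta, classK gamma &
      forall e dx x, sys e dx x -> restriction (e 0%N) dx x ->
        forall k, enorm (e k) <=
          Num.max (beta (enorm (e 0%N)) k%:R)
                  (gamma (seqnorm (fun i => col_mx (dx i) (x i))))].

(* The left-hand side is an extended real, so that the inequality entails
   boundedness of the state; the real-valued limits superior on the right
   are taken along bounded inputs only. *)
Definition asymptotic_gain (gamma : R -> R -> R) : Prop :=
  forall e dx x, sys e dx x -> restriction (e 0%N) dx x ->
    (limn_esup (fun k => (enorm (e k))%:E) <=
     (gamma (limn_sup (fun k => enorm (dx k)))
            (limn_sup (fun k => enorm (x k))))%:E)%E.

End Stability.

(* Indices start at 1. *)
Definition decreasing_from1 (R : realType) (u : nat -> R) : Prop :=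
  forall l m, (0 < l)%N -> (l <= m)%N -> u m <= u l.

(* Main.v *)
Require Import Defs.
From mathcomp Require Import lra ring.

Set Implicit Arguments.
Unset Strict Implicit.
Unset Printing Implicit Defensive.

Local Open Scope classical_set_scope.
Local Open Scope ring_scope.

(** The one-step estimate [|e+| <= a |e| + theta |dx|] is a linear contraction
    with an additive input, but it is granted only while [|e| + b |dx| <= eps].
    The restrictions on the data keep every trajectory inside that region.
    Write [sigma = theta / (1 - a)] and [t = eps / (2 (sigma + b))], so that
    [sigma t] and [b t] add up to [eps / 2].  If [|e| <= eps / 2] and
    [|dx| <= t], then [b |dx| <= eps / 2], so the estimate applies; it bounds
    the next error by [a (eps / 2) + (1 - a) (sigma t)], a convex combination
    of two numbers not exceeding [eps / 2].  This invariance is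
    [restricted_trajectory_stays_in_region].

    Since the estimate then holds at all times, iterating it gives
    [|e_k| <= a^k |e_0| + sigma D] for any bound [D] of the input
    ([contraction_le]).  A sum of two terms is at most the maximum of their
    doubles, whence LISS with [beta r s = 2 a^s r] and [gamma r = 2 sigma r].
    For the asymptotic gain the same iteration is started at a late time, when
    the input is already almost below its limit superior
    ([contraction_limn_esup]).

    Suprema and limits superior of real sequences only have their intended
    meaning on bounded sequences; the inputs are bounded because the states
    [x_k] remain in the compact set [Gamma] and the increments are
    differences of such states. *)

(** * Euclidean norms of vectors and sequences *)

Lemma enorm_ge0 (R : realType) n (v : 'cV[R]_n) : 0 <= enorm v.
Proof. exact: sqrtr_ge0. Qed.

Lemma enorm_col_mx_l (R : realType) m n (v : 'cV[R]_m) (w : 'cV[R]_n) :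
  enorm v <= enorm (col_mx v w).
Proof.
rewrite /enorm ler_sqrt ?big_split_ord /=; last first.
  by apply: addr_ge0; apply: sumr_ge0 => i _; rewrite sqr_ge0.
under [X in _ <= X + _]eq_bigr do rewrite col_mxEu.
by rewrite lerDl; apply: sumr_ge0 => i _; rewrite sqr_ge0.
Qed.

(** Compactness bounds the library norm; this comparison carries the bound over
    to the Euclidean norm. *)
Lemma enorm_le_mx_norm (R : realType) n (v : 'cV[R]_n) :
  enorm v <= Num.sqrt n%:R * `|v|.
Proof.
have entry i : `|v i 0| <= `|v|.
  rewrite [leRHS]/Num.Def.normr /= mx_normrE.
  by apply/bigmax_geP; right => /=; exists (i, 0).
rewrite -[X in _ * X]normr_id -sqrtr_sqr -sqrtrM ?ler0n // /enorm.
rewrite ler_sqrt ?mulr_ge0 ?sqr_ge0 //.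
apply: (@le_trans _ _ (\sum_(i < n) `|v| ^+ 2)).
  by apply: ler_sum => i _; rewrite -real_normK ?num_real // lerXn2r ?nnegrE.
by rewrite sumr_const card_ord mulr_natl.
Qed.

Lemma enorm_le_seqnorm (R : realType) n (u : nat -> 'cV[R]_n) (M : R) :
  (forall k, `|u k| <= M) -> forall k, enorm (u k) <= seqnorm u.
Proof.
move=> uM k; apply: ub_le_sup; last by exists k.
exists (Num.sqrt n%:R * M) => _ [j _ <-].
by apply: le_trans (enorm_le_mx_norm _) _; rewrite ler_wpM2l ?sqrtr_ge0.
Qed.

Lemma mx_norm_col_mx_le (R : realType) m n (v : 'cV[R]_m) (w : 'cV[R]_n)
    (M : R) :
  `|v| <= M -> `|w| <= M -> `|col_mx v w| <= M.
Proof.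
move=> vM wM; rewrite [leLHS]/Num.Def.normr /= mx_normrE.
apply: bigmax_le => /=; first exact: le_trans vM.
move=> [i j] _ /=; rewrite ord1.
case: (split_ordP i) => k ->; rewrite ?col_mxEu ?col_mxEd.
- apply: le_trans vM; rewrite [leRHS]/Num.Def.normr /= mx_normrE.
  by apply/bigmax_geP; right => /=; exists (k, 0).
- apply: le_trans wM; rewrite [leRHS]/Num.Def.normr /= mx_normrE.
  by apply/bigmax_geP; right => /=; exists (k, 0).
Qed.

(** * Limits superior of bounded sequences *)

Lemma limn_sup_lt_near (R : realType) (u : nat -> R) (c : R) :
  has_ubound (range u) -> has_lbound (range u) ->
  limn_sup u < c -> \forall k \near \oo, u k <= c.
Proof.
move=> ub lb.
rewrite /limn_sup (cvg_lim _ (cvg_sups_inf ub lb)) //.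
move=> /inf_lt [|_ [K _ <-] ltc]; first by exists (sups u 0%N); exists 0%N.
exists K => // k /= Kk; apply: le_trans (ltW ltc).
by apply: ub_le_sup; [exact/has_ubound_sdrop | exists k].
Qed.

Lemma limn_sup_ge0 (R : realType) (u : nat -> R) :
  has_ubound (range u) -> (forall k, 0 <= u k) -> 0 <= limn_sup u.
Proof.
move=> ub u0.
have lb : has_lbound (range u) by exists 0 => _ [k _ <-].
rewrite /limn_sup (cvg_lim _ (cvg_sups_inf ub lb)) //.
apply: lb_le_inf; first by exists (sups u 0%N); exists 0%N.
move=> _ [K _ <-]; apply: le_trans (u0 K) _.
by apply: ub_le_sup; [exact/has_ubound_sdrop | exists K => /=].
Qed.

Lemma limn_esup_le_near (R : realType) (u : nat -> \bar R) (c : \bar R) :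
  (\forall k \near \oo, u k <= c)%E -> (limn_esup u <= c)%E.
Proof.
move=> uc; rewrite /limn_esup limf_esupE.
apply: (@le_trans _ _ (ereal_sup [set u k | k in [set k | (u k <= c)%E]])).
  by apply: ereal_inf_lbound; exists [set k | (u k <= c)%E].
by apply: ge_ereal_sup => _ [k /= ukc <-].
Qed.

(** * Scalar contractions with an input *)

Lemma steady_state_fixpoint (R : realType) (a th : R) :
  a < 1 -> a * (th / (1 - a)) + th = th / (1 - a).
Proof. by move=> a1; field; lra. Qed.

(** The induction closes because [th / (1 - a) * c] is the fixed point of
    [r |-> a r + th c]: one step of the recursion shrinks the first term of the
    bound by the factor [a] and leaves the second one unchanged. *)
Lemma contraction_le (R : realType) (y d : nat -> R) (a th c : R) :
  0 <= a < 1 -> 0 <= th -> 0 <= c ->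
  (forall k, y k.+1 <= a * y k + th * d k) -> (forall k, d k <= c) ->
  forall k, y k <= a ^+ k * y 0%N + th / (1 - a) * c.
Proof.
move=> /andP[a0 a1] th0 c0 ystep dc; elim=> [|k IH].
  by rewrite expr0 mul1r lerDl mulr_ge0 ?divr_ge0 // subr_ge0 ltW.
apply: le_trans (ystep k) _.
apply: (@le_trans _ _ (a * (a ^+ k * y 0%N + th / (1 - a) * c) + th * c)).
  by apply: lerD; apply: ler_wpM2l.
rewrite -[in leRHS](steady_state_fixpoint th a1) exprS le_eqVlt.
by apply/orP; left; apply/eqP; ring.
Qed.

(** From a late time on the input is at most its limit superior plus a
    small constant, and the bound of [contraction_le] started at that time
    forgets the value reached there at a geometric rate. *)
Lemma contraction_limn_esup (R : realType) (y d : nat -> R) (a th : R) :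
  0 <= a < 1 -> 0 <= th ->
  (forall k, 0 <= d k) -> has_ubound (range d) ->
  (forall k, y k.+1 <= a * y k + th * d k) ->
  (limn_esup (fun k => (y k)%:E) <= (th / (1 - a) * limn_sup d)%:E)%E.
Proof.
move=> a01 th0 d0 dub ystep.
have /andP[a0 a1] := a01.
have dlb : has_lbound (range d) by exists 0 => _ [k _ <-].
have L0 := limn_sup_ge0 dub d0.
set s := th / (1 - a); set L : R := limn_sup d.
have s0 : 0 <= s by rewrite divr_ge0 // subr_ge0 ltW.
apply/lee_addgt0Pr => e e0; rewrite -EFinD.
(* The denominator has [s + 1] rather than [s], which may vanish. *)
pose r := e / (2 * (s + 1)).
have r0 : 0 < r by rewrite divr_gt0 // mulr_gt0 //; lra.
have sr : s * r <= e / 2.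
  have -> : s * r = e / 2 - r by rewrite /r; field; lra.
  by rewrite gerBl ltW.
have [K _ dK] : \forall k \near \oo, d k <= L + r.
  by apply: limn_sup_lt_near => //; rewrite ltrDl.
have an : `|a| < 1 by rewrite ger0_norm.
have : (fun k => a ^+ k * y K) @ \oo --> 0.
  rewrite -(mul0r (y K)); apply: cvgMl; exact: cvg_expr.
move=> /cvgr_lt /(_ (e / 2)) [|K' _ aK']; first by rewrite divr_gt0.
apply: limn_esup_le_near; exists (K + K')%N => // k /= Kk.
have kK : (K <= k)%N by apply: leq_trans Kk; rewrite leq_addr.
rewrite lee_fin -(subnKC kK).
have Lr0 : 0 <= L + r by rewrite addr_ge0 // ltW.
have ystepK j : y (K + j.+1)%N <= a * y (K + j)%N + th * d (K + j)%N.
  by rewrite addnS.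
have dKj j : d (K + j)%N <= L + r by apply: dK => /=; rewrite leq_addr.
have := contraction_le a01 th0 Lr0 ystepK dKj (k - K).
rewrite addn0 -/s => /le_trans; apply.
have := aK' (k - K)%N; rewrite /= leq_subRL // => /(_ Kk).
rewrite mulrDr; lra.
Qed.

(** * Comparison functions *)

Lemma classK_scale (R : realType) (c : R) :
  0 < c -> classK (fun r : R => c * r).
Proof.
move=> c0; split; last by rewrite mulr0.
- by apply: continuous_subspaceT => r; apply: cvgMr; exact: cvg_id.
- by move=> r s _ rs; rewrite ltr_pM2l.
Qed.

Lemma classKL_exponential (R : realType) (c a : R) : 0 < c -> 0 < a < 1 ->
  classKL (fun r s : R => c * a `^ s * r).
Proof.
move=> c0 /andP[a0 a1]; split.
  by move=> s _; apply: classK_scale; rewrite mulr_gt0 ?powR_gt0.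
move=> r _.
have lna : 0 < - ln a by rewrite oppr_gt0 ln_lt0 // a0 a1.
have : expR (- (s * - ln a)) @[s --> +oo] --> (0 : R).
  apply: (cvg_comp (fun s : R => s * - ln a) (fun t => expR (- t))).
    by apply: gt0_cvgMly => //; exact: cvg_id.
  exact: cvgr_expR.
move=> lim; have -> : 0 = c * 0 * r :> R by rewrite mulr0 mul0r.
apply: cvgMl.
apply: cvgMr; apply: cvg_trans lim; apply: near_eq_cvg; apply: nearW => s /=.
by rewrite /powR gt_eqF // mulrN opprK.
Qed.

(** * The error system *)

(** The threshold on [d] is the number [t] for which [(s + b) t] is half of
    [eps]: [s t <= eps / 2] keeps the ball of radius [eps / 2] invariant, and
    [b t <= eps / 2] leaves room for [b * d k] next to it.  The step hypothesis
    is conditional, so invariance and its applicability are proved together. *)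
Lemma restricted_trajectory_stays_in_region (R : realType) (y d : nat -> R)
    (a th b eps : R) :
  let s := th / (1 - a) in
  0 < a < 1 -> 0 < th -> 0 <= b -> 0 < eps ->
  (forall k, y k + b * d k <= eps -> y k.+1 <= a * y k + th * d k) ->
  y 0%N <= 2^-1 * eps -> (forall k, d k <= 2^-1 * (s + b)^-1 * eps) ->
  forall k, y k + b * d k <= eps.
Proof.
move=> s /andP[a0 a1] th0 b0 eps0 ystep y0 dtau.
have s0 : 0 < s by rewrite divr_gt0 // subr_gt0.
set t := 2^-1 * (s + b)^-1 * eps in dtau.
have t0 : 0 <= t by rewrite !mulr_ge0 ?invr_ge0 ?addr_ge0 // ltW.
have tE : s * t + b * t = 2^-1 * eps by rewrite /t; field; lra.
have st0 : 0 <= s * t by rewrite mulr_ge0 // ltW.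
have bt0 : 0 <= b * t by rewrite mulr_ge0.
have ball k : y k <= 2^-1 * eps -> y k + b * d k <= eps.
  move=> yk; have : b * d k <= b * t by rewrite ler_wpM2l.
  by lra.
suff inv k : y k <= 2^-1 * eps by move=> k; apply: ball.
elim: k => [//|k IH]; apply: le_trans (ystep k (ball k IH)) _.
apply: (@le_trans _ _ (a * (2^-1 * eps) + th * t)).
  by apply: lerD; apply: ler_wpM2l => //; apply: ltW.
have thE : th * t = (1 - a) * (s * t) by rewrite /s; field; lra.
have : (1 - a) * (s * t) <= (1 - a) * (2^-1 * eps).
  by apply: ler_wpM2l; lra.
by rewrite thE; lra.
Qed.

Lemma Gamma_bounded (R : realType) nx nu nd N (P : ocp R nx nu nd N) :
  ocp_assumptions P -> exists M, forall x, Gamma P x -> `|x| <= M.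
Proof.
move=> /Gamma_compact /compact_bounded [M [_ MG]].
by exists (M + 1) => x; apply: MG; rewrite ltrDl.
Qed.

Lemma steady_state_gain_decreasing (R : realType) (a th : nat -> R) :
  (forall l, (0 < l)%N -> 0 < a l < 1) -> (forall l, (0 < l)%N -> 0 < th l) ->
  decreasing_from1 a -> decreasing_from1 th ->
  decreasing_from1 (fun l => th l / (1 - a l)).
Proof.
move=> a01 th0 adecr thdecr l m l0 lm.
have m0 : (0 < m)%N by apply: leq_trans lm.
have /andP[_ al1] := a01 l l0; have /andP[_ am1] := a01 m m0.
have alm := adecr l m l0 lm.
apply: ler_pM; [exact: ltW (th0 m m0) | | exact: thdecr |].
  by rewrite invr_ge0; lra.
by rewrite lef_pV2 ?posrE; lra.
Qed.

Lemma steady_state_gain_cvg0 (R : realType) (a th : nat -> R) :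
  a @ \oo --> 0 -> th @ \oo --> 0 -> (fun l => th l / (1 - a l)) @ \oo --> 0.
Proof.
move=> a0 th0.
have -> : 0 = 0 / (1 - 0) :> R by rewrite mul0r.
apply: cvgM => //; apply: cvgV; first by rewrite subr0 oner_eq0.
by apply: cvgB => //; exact: cvg_cst.
Qed.

Theorem theorem3 (R : realType) (nx nu nd N n : nat)
    (P : ocp R nx nu nd N) (hP : ocp_assumptions P)
    (jmu : 'I_nu * 'I_N -> 'I_n)
    (F : 'cV[R]_n -> 'cV[R]_nx -> 'cV[R]_n) (K : set 'cV[R]_n)
    (hFK : first_order_conditions P jmu F K)
    (T : 'cV[R]_n -> 'cV[R]_nx -> nat -> 'cV[R]_n) (eps eta q : R)
    (hT : q_linearly_convergent P F K T eps eta q)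
    (hreg : forall (x : 'cV[R]_nx) (z : 'cV[R]_n),
       Gamma P x -> ge_sol F K x z -> represents_minimizer P jmu x z ->
       strongly_regular (ge_map F K x) z 0)
    (sbar : 'cV[R]_nx -> 'cV[R]_n) (b : R)
    (hsbar : isolated_minimizer_selection P jmu F K sbar b)
    (Xi : 'M[R]_(nu, n)) (hXi : selects_mu0 jmu Xi)
    (a theta : nat -> R)
    (ha01 : forall l : nat, (0 < l)%N -> 0 < a l < 1)
    (hadecr : decreasing_from1 a) (ha0 : a @ \oo --> 0)
    (htheta_pos : forall l : nat, (0 < l)%N -> 0 < theta l)
    (hthetadecr : decreasing_from1 theta) (htheta0 : theta @ \oo --> 0)
    (hbound : forall l : nat, (0 < l)%N ->
       forall (e : nat -> 'cV[R]_n) (dx x : nat -> 'cV[R]_nx),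
       error_system P T sbar l e dx x ->
       forall k : nat, enorm (e k) + b * enorm (dx k) <= eps ->
       enorm (e k.+1) <= a l * enorm (e k) + theta l * enorm (dx k)) :
  let sigma : nat -> R := fun l => theta l / (1 - a l) in
  let restr : R -> R -> 'cV[R]_n ->
      (nat -> 'cV[R]_nx) -> (nat -> 'cV[R]_nx) -> Prop :=
    fun r_e r_dx e0 dx _ => enorm e0 <= r_e /\ seqnorm dx <= r_dx in
  (exists tau : nat -> R, forall l : nat, (0 < l)%N ->
     [/\ tau l = 2^-1 * (sigma l + b)^-1,
         0 < tau l,
         LISS (error_system P T sbar l) (restr (2^-1 * eps) (tau l * eps)) &
         asymptotic_gain (error_system P T sbar l)
           (restr (2^-1 * eps) (tau l * eps))
           (fun s1 s2 => 2 * sigma l * s1 + 0 * s2)]) /\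
  decreasing_from1 sigma /\ sigma @ \oo --> 0.
Proof.
move=> sigma restr; split; last first.
  by split; [exact: steady_state_gain_decreasing | exact: steady_state_gain_cvg0].
exists (fun l => 2^-1 * (sigma l + b)^-1) => l l0.
have /andP[a0 a1] := ha01 l l0; have th0 := htheta_pos l l0.
have eps0 : 0 < eps by case: hT.
have b0 := sel_const_ge0 hsbar.
have s0 : 0 < sigma l by rewrite divr_gt0 // subr_gt0.
have [M GM] := Gamma_bounded hP.
have dx_bound e dx x : error_system P T sbar l e dx x ->
    forall k, `|dx k| <= 2 * M.
  move=> sys k; have [Gk xS _] := sys k; have [Gk' _ _] := sys k.+1.
  have -> : dx k = x k.+1 - x k by rewrite xS addrC addKr.
  by apply: le_trans (ler_normB _ _) _; have := GM _ Gk; have := GM _ Gk'; lra.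
have col_bound e dx x : error_system P T sbar l e dx x ->
    forall k, `|col_mx (dx k) (x k)| <= 2 * M.
  move=> sys k; apply: mx_norm_col_mx_le; first exact: dx_bound sys k.
  have [/GM xM _ _] := sys k; have := normr_ge0 (x k); lra.
have step e dx x : error_system P T sbar l e dx x ->
    restr (2^-1 * eps) (2^-1 * (sigma l + b)^-1 * eps) (e 0%N) dx x ->
    forall k, enorm (e k.+1) <= a l * enorm (e k) + theta l * enorm (dx k).
  move=> sys [e0 dxtau] k; apply: (hbound l l0 _ _ _ sys).
  apply: (@restricted_trajectory_stays_in_region _ (fun k => enorm (e k))
    (fun k => enorm (dx k)) (a l) (theta l)) => //.
  - exact: ha01.
  - exact: hbound l l0 _ _ _ sys.
  - move=> j; apply: le_trans dxtau.
    exact: enorm_le_seqnorm (dx_bound _ _ _ sys) j.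
split => //.
- by rewrite mulr_gt0 ?invr_gt0 // ltr_pwDl.
- exists (fun r s => 2 * a l `^ s * r), (fun r => 2 * sigma l * r); split.
  + by apply: classKL_exponential => //; apply: ha01.
  + by apply: classK_scale; rewrite mulr_gt0.
  move=> e dx x sys res k.
  (* LISS measures the input by the stacked vector, whose norm dominates that
     of its block [dx]. *)
  have := @contraction_le _ (fun k => enorm (e k)) (fun k => enorm (dx k))
    (a l) (theta l) (seqnorm (fun i => col_mx (dx i) (x i))).
  rewrite (ltW a0) a1 (ltW th0) => /(_ isT isT _ (step _ _ _ sys res) _ k).
  have dxle j : enorm (dx j) <= seqnorm (fun i => col_mx (dx i) (x i)).
    apply: le_trans (enorm_col_mx_l _ (x j)) _.
    exact: (@enorm_le_seqnorm _ _ (fun i => col_mx (dx i) (x i)) _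
      (col_bound _ _ _ sys) j).
  move=> /(_ (le_trans (enorm_ge0 _) (dxle 0%N)) dxle) H; apply: le_trans H _.
  rewrite powR_mulrn ?(ltW a0) // -[theta l / _]/(sigma l) -!(mulrA 2) le_max.
  set u := a l ^+ k * _; set v := sigma l * _.
  by have [uv|vu] := leP u v; apply/orP; [right|left]; lra.
- move=> e dx x sys res.
  have dub : has_ubound (range (fun k => enorm (dx k))).
    exists (seqnorm dx) => _ [k _ <-].
    exact: enorm_le_seqnorm (dx_bound _ _ _ sys) k.
  apply: le_trans
    (contraction_limn_esup _ (ltW th0) _ dub (step _ _ _ sys res)) _.
  + by rewrite (ltW a0).
  + by move=> k; exact: enorm_ge0.
  rewrite lee_fin mul0r addr0 -[theta l / _]/(sigma l) -(mulrA 2).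
  rewrite ler_peMl ?ler1n //.
  apply: mulr_ge0; first exact: ltW.
  by apply: limn_sup_ge0 => // k; exact: enorm_ge0.
Qed.
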